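(* For non-negative integers $r,s$ and non-negative integers $m\geq n$, $$\sum_{k=0}^n\frac{(m-2k)\binom{m+r+s}{m,r,s}\binom{m}{k}\binom{m+2r}{k+r}\binom{m+2s}{k+s}}{\binom{m+2r}{m+r}\binom{m+2s}{m+s}\binom{m+s}{n+s}}=(m-n)\sum_{j=0}^{m-n+r-1}\binom{n+j}{n}\binom{n+j+s}{m-n+s-1}.$$
   Context: Here $\binom{m+r+s}{m,r,s}=\frac{(m+r+s)!}{m!\,r!\,s!}$ is the multinomial coefficient. Convention: an empty sum equals $0$, and $\binom{N}{k}=0$ whenever $k<0$ or $k>N$. *)

(* Defs.v *)
From mathcomp Require Import all_boot all_order all_algebra.
Set Implicit Arguments.
Unset Strict Implicit.
Unset Printing Implicit Defensive.
Import Order.TTheory GRing.Theory Num.Theory.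
Local Open Scope ring_scope.

(* Binomial coefficient with an integer lower index: zero when [k < 0], and
   also when [k > N] since ['C(N, k)] already vanishes there. *)
Definition binz (N : nat) (k : int) : nat :=
  match k with
  | Posz i => 'C(N, i)
  | Negz _ => 0%N
  end.

Definition multinom3 (a b c : nat) : rat :=
  ((a + b + c)`!)%:R / ((a`!)%:R * (b`!)%:R * (c`!)%:R).

(* Main.v *)
Require Import Defs.
From mathcomp Require Import all_boot all_order all_algebra.
From mathcomp Require Import ring zify.
Import Order.TTheory GRing.Theory Num.Theory.
Local Open Scope ring_scope.

(** Writing [M = m + r], the [k]-th summand is, up to the factor
    [1 / 'C(m + s, n + s)], equal to
    [t(M, k) = (m - 2k) 'C(m+s, k+s) 'C(M, k) 'C(M+s, m-k+s)],
    which makes sense for every [M], i.e. also for negative [r].  Its difference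
    in [M] telescopes in [k]:  [t(M+1, k) - t(M, k) = G(M, k) - G(M, k-1)] with
    [G(M, k) = (m - k) 'C(m+s, k+s) 'C(M, k) 'C(M+s, m-k+s-1)].
    Summing over [k <= n], and then over [M] from [n] to [m + r - 1], gives the
    right-hand side, once the sum is known to vanish for [M = n].  There
    ['C(n, k) = 0] for [k > n], so the sum may be extended to [k <= m], and the
    full sum vanishes since [t] is antisymmetric under [k -> m - k]. *)

Definition bin_weight (m s M k : nat) : nat :=
  'C(m + s, k + s) * 'C(M, k) * 'C(M + s, m - k + s).

Definition skew_term (m s M k : nat) : rat :=
  (m%:R - (2 * k)%N%:R) * (bin_weight m s M k)%:R.

Lemma fact_natr_neq0 (F : numFieldType) (a : nat) : a`!%:R != 0 :> F.
Proof. by rewrite pnatr_eq0 -lt0n fact_gt0. Qed.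

Lemma natr_bin_fact (F : numFieldType) (N a b : nat) : N = (a + b)%N ->
  'C(N, a)%:R = N`!%:R / (a`!%:R * b`!%:R) :> F.
Proof.
move=> ->; rewrite -(bin_fact (leq_addr b a)) addKn !natrM mulfK //.
by rewrite mulf_neq0 // fact_natr_neq0.
Qed.

(** The difference [N - k] is taken in the ring, so no bound on [k] is needed: past [N] both
    binomials vanish. *)
Lemma natr_mul_bin_left (R : pzRingType) (N k : nat) :
  k.+1%:R * 'C(N, k.+1)%:R = (N%:R - k%:R) * 'C(N, k)%:R :> R.
Proof.
case: (leqP k N) => [le_kN|lt_Nk]; first by rewrite -natrB // -!natrM mul_bin_left.
by rewrite !bin_small ?mulr0 // ltnW.
Qed.

(** With [m = k + l], the factorial form is symmetric in [k] and [l]; if either exceeds [M], both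
    sides vanish. *)
Lemma bin_weight_sym (m s M k : nat) : (k <= m)%N ->
  bin_weight m s M (m - k) = bin_weight m s M k.
Proof.
move=> le_km; rewrite /bin_weight subKn //.
move: (m - k)%N (subnKC le_km) => l <- {m le_km}.
case: (leqP k M) => [le_kM|lt_Mk]; last first.
  by rewrite (@bin_small M k) // (@bin_small (M + s) (k + s)) ?ltn_add2r // !muln0.
case: (leqP l M) => [le_lM|lt_Ml]; last first.
  by rewrite (@bin_small M l) // (@bin_small (M + s) (l + s)) ?ltn_add2r // !muln0.
apply/eqP; rewrite -(eqr_nat rat) !natrM; apply/eqP.
rewrite (@natr_bin_fact _ (k + l + s) (l + s) k); last by lia.
rewrite (@natr_bin_fact _ (k + l + s) (k + s) l); last by lia.
rewrite (@natr_bin_fact _ M l (M - l)); last by lia.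
rewrite (@natr_bin_fact _ M k (M - k)); last by lia.
rewrite (@natr_bin_fact _ (M + s) (k + s) (M - k)); last by lia.
rewrite (@natr_bin_fact _ (M + s) (l + s) (M - l)); last by lia.
by field; rewrite !fact_natr_neq0.
Qed.

Lemma sum_skew_term_full (m s M : nat) :
  \sum_(0 <= k < m.+1) skew_term m s M k = 0.
Proof.
set S := LHS.
have SN : S = - S.
  rewrite {1}/S big_nat_rev /= /S -sumrN; apply: eq_big_nat => k /andP[_].
  rewrite ltnS add0n subSS => le_km; rewrite /skew_term bin_weight_sym // -mulNr.
  by congr (_ * _); rewrite !natrM natrB //; ring.
by apply/eqP; rewrite -[_ == 0](mulrn_eq0 S 2) mulr2n {1}SN addNr.
Qed.

Lemma sum_skew_term_base (m n s : nat) : (n <= m)%N ->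
  \sum_(0 <= k < n.+1) skew_term m s n k = 0.
Proof.
move=> le_nm; rewrite -[RHS](sum_skew_term_full m s n).
rewrite [RHS](big_cat_nat (n := n.+1)) //= [X in _ = _ + X]big1_seq ?addr0 //.
move=> k /andP[_]; rewrite mem_index_iota => /andP[lt_nk _].
by rewrite /skew_term /bin_weight (bin_small lt_nk) muln0 mul0n mulr0.
Qed.

(** The right-hand side is [G(M, n)], with [m - n = d + 1]. The induction step passes from
    [(n, d + 1)] to [(n + 1, d)], which keeps [m] fixed. *)
Lemma sum_skew_term_diff (n d s M : nat) (m := (n + d.+1)%N) :
  \sum_(0 <= k < n.+1) (skew_term m s M.+1 k - skew_term m s M k)
  = d.+1%:R * 'C(m + s, n + s)%:R * 'C(M, n)%:R * 'C(M + s, d + s)%:R.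
Proof.
rewrite {}/m; elim: n d => [|n IHn] d.
  rewrite big_nat1 /skew_term /bin_weight !bin0 !add0n subn0 !addSn binS.
  by rewrite !muln1 muln0 !natrM natrD; ring.
rewrite big_nat_recr //= addSnnS IHn /skew_term /bin_weight.
have -> : (n + d.+2 - n.+1 = d.+1)%N by lia.
rewrite !addSn !binS !natrM !natrD.
(* The two sides differ by a combination of three instances of the absorption identity
   [e N k = 0]. *)
pose e (N k : nat) : rat :=
  k.+1%:R * 'C(N, k.+1)%:R - (N%:R - k%:R) * 'C(N, k)%:R.
have [E1 E2 E3] : [/\ e (n + d.+2 + s) (n + s) = 0, e M n = 0
    & e (M + s) (d + s) = 0].
  by split; rewrite /e natr_mul_bin_left subrr.
apply/eqP; rewrite -subr_eq0; apply/eqP.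
transitivity ('C(n + d.+2 + s, (n + s).+1)%:R * 'C(M, n)%:R * e (M + s) (d + s)
  - 'C(n + d.+2 + s, (n + s).+1)%:R * 'C(M + s, d + s)%:R * e M n
  - 'C(M, n)%:R * 'C(M + s, (d + s).+1)%:R * e (n + d.+2 + s) (n + s)); last first.
  by rewrite E1 E2 E3; ring.
by rewrite /e !natrD; ring.
Qed.

Theorem theorem2p2 (m n r s : nat) (le_nm : (n <= m)%N) :
  \sum_(0 <= k < n.+1)
     ((m%:R - (2 * k)%N%:R) * multinom3 m r s * 'C(m, k)%:R
        * 'C(m + 2 * r, k + r)%:R * 'C(m + 2 * s, k + s)%:R)
     / ('C(m + 2 * r, m + r)%:R * 'C(m + 2 * s, m + s)%:R
        * 'C(m + s, n + s)%:R)
  = (m%:R - n%:R)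
    * \sum_(0 <= j < m - n + r)
        'C(n + j, n)%:R
        * (binz (n + j + s) (m%:Z - n%:Z + s%:Z - 1))%:R :> rat.
Proof.
have C_neq0 : 'C(m + s, n + s)%:R != 0 :> rat.
  by rewrite pnatr_eq0 -lt0n bin_gt0 leq_add2r.
transitivity ((\sum_(0 <= k < n.+1) skew_term m s (m + r) k) / 'C(m + s, n + s)%:R).
  rewrite mulr_suml; apply: eq_big_nat => k /andP[_]; rewrite ltnS => le_kn.
  have le_km := leq_trans le_kn le_nm.
  rewrite invfM mulrA; congr (_ / _).
  rewrite /skew_term /bin_weight -!mulrA; congr (_ * _).
  move: (m - k)%N (subnKC le_km) => l <-.
  rewrite !natrM /multinom3.
  rewrite (@natr_bin_fact _ (k + l) k l); last by lia.
  rewrite (@natr_bin_fact _ (k + l + 2 * r) (k + r) (l + r)); last by lia.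
  rewrite (@natr_bin_fact _ (k + l + 2 * s) (k + s) (l + s)); last by lia.
  rewrite (@natr_bin_fact _ (k + l + 2 * r) (k + l + r) r); last by lia.
  rewrite (@natr_bin_fact _ (k + l + 2 * s) (k + l + s) s); last by lia.
  rewrite (@natr_bin_fact _ (k + l + s) (k + s) l); last by lia.
  rewrite (@natr_bin_fact _ (k + l + r) k (l + r)); last by lia.
  rewrite (@natr_bin_fact _ (k + l + r + s) (l + s) (k + r)); last by lia.
  by field; rewrite !fact_natr_neq0.
(* For [n = m] the left side is already the full antisymmetric sum. *)
case: (ltngtP n m) le_nm C_neq0 => // [lt_nm _ C_neq0|-> _ _]; last first.
  by rewrite sum_skew_term_full subrr !mul0r.
have [d mE] : exists d, m = (n + d.+1)%N by exists (m - n).-1; lia.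
apply: canLR (mulfK C_neq0) _.
(* Induct on the length [N] of the right-hand sum, with [M = n + N] and [m] fixed. *)
have -> : (m + r = n + (m - n + r))%N by lia.
elim: (m - n + r)%N => [|N IHN].
  by rewrite addn0 sum_skew_term_base 1?ltnW // big_geq // mulr0 mul0r.
rewrite [X in _ = _ * X * _]big_nat_recr //= mulrDr mulrDl -IHN addnS.
apply/eqP; rewrite addrC -subr_eq -sumrB; apply/eqP.
rewrite mE sum_skew_term_diff.
(* As [n < m], the lower index is non-negative and [binz] is an ordinary binomial. *)
have -> : (n + d.+1)%:Z - n%:Z + s%:Z - 1 = (d + s)%N by lia.
by rewrite /= natrD; ring.
Qed.
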